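(* Let $V:\mathbb{R}^n\to\mathbb{R}$ be continuously differentiable and $\mu$-convex for some $\mu\ge0$. Let $x\in\mathbb{R}^n$ and $\tau>0$. If $\overline{\nabla}V$ is the mean value discrete gradient or the Itoh--Abe discrete gradient of $V$, then the solution $y\in\mathbb{R}^n$ of $$y=x-\tau\,\overline{\nabla}V(x,y)$$ is unique, i.e. if $y_1$ and $y_2$ both solve this equation, then $y_1=y_2$.
   Context: $V$ is $\mu$-convex ($\mu\ge0$) if $V(\cdot)-\frac{\mu}{2}\|\cdot\|^2$ is convex, where $\|\cdot\|$ is the Euclidean norm. Mean value discrete gradient: $\overline{\nabla}V(x,y)=\int_0^1\nabla V((1-s)x+sy)\,ds$. Itoh--Abe discrete gradient: the $i$-th component is $$(\overline{\nabla}V(x,y))_i=\frac{V(y_1,\ldots,y_i,x_{i+1},\ldots,x_n)-V(y_1,\ldots,y_{i-1},x_i,\ldots,x_n)}{y_i-x_i},\quad i=1,\ldots,n,$$ where, if $y_i=x_i$, the quotient $0/0$ is interpreted as $\partial_iV(y_1,\ldots,y_{i-1},x_i,\ldots,x_n)$. *)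

(* Defs.v *)
From HB Require Import structures.
From mathcomp Require Import all_boot all_order all_algebra.
From mathcomp Require Import all_classical all_reals all_analysis.
Set Implicit Arguments.
Unset Strict Implicit.
Unset Printing Implicit Defensive.
Import Order.TTheory GRing.Theory Num.Theory.
Import numFieldNormedType.Exports.
Local Open Scope classical_set_scope.
Local Open Scope ring_scope.

(* The canonical norm `|x| on 'rV[R]_n is the sup norm. *)
Definition enorm (R : realType) (n : nat) (x : 'rV[R]_n) : R :=
  Num.sqrt (\sum_(i < n) x ord0 i ^+ 2).

Definition mu_convex (R : realType) (n : nat) (mu : R) (V : 'rV[R]_n -> R) :
    Prop :=
  convex_function (setT : set (convex_lmodType 'rV[R]_n))
    (fun x => V x - mu / 2 * enorm x ^+ 2).

Definition partial_deriv (R : realType) (n : nat) (V : 'rV[R]_n -> R)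
    (i : 'I_n) (x : 'rV[R]_n) : R :=
  'D_(delta_mx ord0 i) V x.

Definition grad (R : realType) (n : nat) (V : 'rV[R]_n -> R) (x : 'rV[R]_n) :
    'rV[R]_n :=
  \row_(i < n) partial_deriv V i x.

Definition continuously_differentiable (R : realType) (n : nat)
    (V : 'rV[R]_n -> R) : Prop :=
  (forall x, differentiable V x) /\ continuous (grad V).

Definition mean_value_dgrad (R : realType) (n : nat) (V : 'rV[R]_n -> R)
    (x y : 'rV[R]_n) : 'rV[R]_n :=
  \row_(i < n) \int[lebesgue_measure]_(s in `[0, 1])
                  grad V ((1 - s) *: x + s *: y) ord0 i.

(* (y_1, ..., y_k, x_(k+1), ..., x_n) *)
Definition splice (R : realType) (n : nat) (k : nat) (x y : 'rV[R]_n) :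
    'rV[R]_n :=
  \row_(j < n) if (j < k)%N then y ord0 j else x ord0 j.

(* Coordinates are numbered from 0: i : 'I_n stands for the component i.+1 of
   the usual 1-based formula. *)
Definition itoh_abe_dgrad (R : realType) (n : nat) (V : 'rV[R]_n -> R)
    (x y : 'rV[R]_n) : 'rV[R]_n :=
  \row_(i < n)
    if y ord0 i == x ord0 i then partial_deriv V i (splice i x y)
    else (V (splice i.+1 x y) - V (splice i x y)) / (y ord0 i - x ord0 i).

(* Main.v *)
(* For the mean value discrete gradient, pair the difference of the two
   equations with y1 - y2: since
   ((1 - s) x + s y1) - ((1 - s) x + s y2) = s (y1 - y2), monotonicity of the
   gradient of the convex function V gives |y1 - y2|^2 <= 0.  For the Itoh-Abe
   discrete gradient, argue coordinate by coordinate: once the coordinates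
   before i agree, the i-th equation is scalar and its right-hand side is a
   nonincreasing function of y_i, because the difference quotients of a convex
   function are nondecreasing. *)
Require Import Defs.
From HB Require Import structures.
From mathcomp Require Import all_boot all_order all_algebra.
From mathcomp Require Import all_classical all_reals all_analysis.
From mathcomp Require Import ring lra.
Import Order.TTheory GRing.Theory Num.Theory.
Import numFieldNormedType.Exports.
Local Open Scope ring_scope.

Section Convexity.
Context {R : realType} {n : nat}.
Implicit Types (V : 'rV[R]_n -> R) (a v : 'rV[R]_n).

Lemma enorm_sqr a : enorm a ^+ 2 = \sum_(i < n) a ord0 i ^+ 2.
Proof. by rewrite sqr_sqrtr // sumr_ge0 // => i _; rewrite sqr_ge0. Qed.

(** In each coordinate the right side exceeds the left by [t * (1 - t) * v_i ^+ 2]. *)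
Lemma enorm_sqr_convex a v (t : R) : 0 <= t <= 1 ->
  enorm (a + t *: v) ^+ 2 <=
  enorm a ^+ 2 + t * (enorm (a + v) ^+ 2 - enorm a ^+ 2).
Proof.
move=> /andP[t0 t1]; rewrite !enorm_sqr -sumrB mulr_sumr -big_split /=.
apply: ler_sum => i _; rewrite !mxE -subr_ge0.
have -> : a ord0 i ^+ 2 + t * ((a ord0 i + v ord0 i) ^+ 2 - a ord0 i ^+ 2) -
    (a ord0 i + t * v ord0 i) ^+ 2 = t * (1 - t) * v ord0 i ^+ 2 by ring.
by rewrite mulr_ge0 ?sqr_ge0// mulr_ge0// subr_ge0.
Qed.

(** Convexity by base point and direction, the form in which directional derivatives and difference
    quotients can be compared directly. *)
Definition convex_along_lines V := forall a v (t : R), 0 <= t <= 1 ->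
  V (a + t *: v) <= V a + t * (V (a + v) - V a).

(** Adding back the convex term [mu / 2 * enorm x ^+ 2] preserves convexity since [mu] is
    nonnegative. *)
Lemma mu_convex_along_lines mu V :
  0 <= mu -> mu_convex mu V -> convex_along_lines V.
Proof.
move=> mu0 cV a v t t01; have /andP[t0 t1] := t01.
(* The weights in [convex_function] have an interval type, so [t] is packed with its bounds; it
   weighs the first point, here [a + v]. *)
have tI : Itv.spec (@Itv.num_sem R) (Itv.Real `[0%Z, 1%Z]) t.
  by rewrite /= /Itv.num_sem /= in_itv /= t0 t1 num_real.
have /= := cV (Itv.mk tI) (a + v) a (in_setT _) (in_setT _).
rewrite convRE /conv /= (_ : t *: (a + v) + _ = a + t *: v); last first.
  by apply/rowP => i; rewrite !mxE /unstable.onem; ring.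
have := ler_wpM2l (divr_ge0 mu0 (ler0n _ 2)) (enorm_sqr_convex a v t t01).
rewrite /unstable.onem; set E1 := enorm _ ^+ 2; set E2 := enorm a ^+ 2.
set E3 := enorm _ ^+ 2; lra.
Qed.

(** The derivative is the limit from the right of quotients that convexity bounds by the full
    increment once [0 < h <= 1]. *)
Lemma derive_le_increment V a v : convex_along_lines V ->
  differentiable V a -> 'D_v V a <= V (a + v) - V a.
Proof.
move=> cV dV.
have /cvg_dnbhs_at_right cD :
    ((fun h : R => h^-1 *: (V (h *: v + a) - V a)) @ 0^' --> 'D_v V a)%classic.
  exact: diff_derivable.
apply: (cvgr_to_le cD).
near=> h.
have h0 : 0 < h by near: h; exact: nbhs_right_gt.
rewrite ler_pdivrMl // lerBlDl [h *: v + a]addrC; apply: cV.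
by rewrite ltW //=; near: h; exact: nbhs_right_le.
Unshelve. all: by end_near.
Qed.

Lemma derive_sum_partial V a v : differentiable V a ->
  'D_v V a = \sum_(i < n) v ord0 i * partial_deriv V i a.
Proof.
move=> dV; rewrite deriveE // {1}[v]row_sum_delta linear_sum.
by apply: eq_bigr => i _; rewrite linearZ /partial_deriv deriveE.
Qed.

(** Add the tangent inequalities from [a] to [b] and from [b] to [a]: the increments of [V]
    cancel. *)
Lemma grad_monotone V a b : convex_along_lines V ->
  (forall z, differentiable V z) ->
  0 <= \sum_(i < n) (a - b) ord0 i * (grad V a ord0 i - grad V b ord0 i).
Proof.
move=> cV dV.
have ab := derive_le_increment V a (b - a) cV (dV a).
have ba := derive_le_increment V b (a - b) cV (dV b).
rewrite [a + _]addrC subrK derive_sum_partial // in ab.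
rewrite [b + _]addrC subrK derive_sum_partial // in ba.
have := lerD ab ba; rewrite addrA subrK subrr -big_split /= -oppr_ge0 -sumrN.
congr (0 <= _); apply: eq_bigr => i _; rewrite !mxE; ring.
Qed.

End Convexity.

Section DifferenceQuotient.
Context {R : realType} {n : nat}.
Implicit Types (V : 'rV[R]_n -> R) (z : 'rV[R]_n) (h : R).

Definition partial_quotient V (i : 'I_n) z h :=
  if h == 0 then partial_deriv V i z
  else (V (z + h *: delta_mx ord0 i) - V z) / h.

(** The tangent bound [Df] puts quotients with negative increment below [D] and those with positive
    increment above it. For increments of equal sign, the one nearer 0 is a fraction of the other,
    and [chord] applies. *)
Lemma partial_quotient_nondecreasing V i z :
  convex_along_lines V -> differentiable V z ->
  {homo partial_quotient V i z : h k / h <= k}.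
Proof.
move=> cV dV h k; rewrite le_eqVlt => /predU1P[->//|hk].
rewrite /partial_quotient.
set e := delta_mx ord0 i; set D := partial_deriv V i z.
pose f t := V (z + t *: e).
have Df t : t * D <= f t - V z.
  have := derive_le_increment V z (t *: e) cV dV.
  by rewrite deriveE // linearZ /= -deriveE.
have chord t u : 0 <= t <= 1 -> f (t * u) - V z <= t * (f u - V z).
  by move=> /(cV z (u *: e)); rewrite scalerA -lerBlDl.
rewrite -/(f h) -/(f k).
have [h0|h0|h0] := ltgtP h 0; have [k0|k0|k0] := ltgtP k 0.
- rewrite ler_ndivlMr // mulrAC -mulrA mulrC.
  have := chord (k / h) h; rewrite divfK ?lt_eqF//; apply.
  by rewrite ler_ndivlMr // mul0r (ltW k0) ler_ndivrMr // mul1r ltW.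
- rewrite (@le_trans _ _ D) //.
    by rewrite ler_ndivrMr // mulrC.
  by rewrite ler_pdivlMr // mulrC.
- by rewrite ler_ndivrMr // mulrC.
- by move: (lt_trans h0 hk); rewrite ltNge (ltW k0).
- rewrite ler_pdivrMr // mulrAC -mulrA mulrC.
  have := chord (h / k) k; rewrite divfK ?gt_eqF//; apply.
  by rewrite divr_ge0 ?(ltW k0) ?(ltW h0) //= ler_pdivrMr // mul1r ltW.
- by move: hk; rewrite k0 ltNge (ltW h0).
- by move: hk; rewrite h0 ltNge (ltW k0).
- by rewrite ler_pdivlMr // mulrC.
- by [].
Qed.

Lemma spliceS (x y : 'rV[R]_n) (i : 'I_n) :
  splice i.+1 x y =
  splice i x y + (y ord0 i - x ord0 i) *: delta_mx ord0 i.
Proof.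
apply/rowP => j; rewrite !mxE eqxx /= ltnS leq_eqVlt.
have [->|ji] := eqVneq j i; first by rewrite eqxx ltnn mulr1 addrC subrK.
by rewrite (inj_eq val_inj) (negbTE ji) mulr0 addr0.
Qed.

Lemma itoh_abe_quotient V (x y : 'rV[R]_n) (i : 'I_n) :
  itoh_abe_dgrad V x y ord0 i =
  partial_quotient V i (splice i x y) (y ord0 i - x ord0 i).
Proof. by rewrite mxE /partial_quotient subr_eq0 spliceS. Qed.

Lemma itoh_abe_step_inj V (x y1 y2 : 'rV[R]_n) (tau : R) :
  convex_along_lines V -> (forall z, differentiable V z) -> 0 < tau ->
  y1 = x - tau *: itoh_abe_dgrad V x y1 ->
  y2 = x - tau *: itoh_abe_dgrad V x y2 -> y1 = y2.
Proof.
move=> cV dV tau0 y1E y2E.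
suff E m : forall i : 'I_n, (i < m)%N -> y1 ord0 i = y2 ord0 i.
  by apply/rowP => i; apply: (E n).
elim: m => // m IH i; rewrite ltnS => im.
(* [splice i] reads only the coordinates of [y] before [i], which agree by induction, so both scalar
   equations involve the same quotient function. *)
have splE : splice i x y1 = splice i x y2.
  apply/rowP => j; rewrite !mxE; case: ifP => // ji.
  exact/IH/(leq_trans ji).
have coord y : y = x - tau *: itoh_abe_dgrad V x y -> y ord0 i =
    x ord0 i - tau * partial_quotient V i (splice i x y) (y ord0 i - x ord0 i).
  by move=> yE; rewrite -itoh_abe_quotient {1}yE !mxE.
have := coord _ y1E; have := coord _ y2E; rewrite splE.
have := partial_quotient_nondecreasing V i (splice i x y2) cV (dV _).
move: (partial_quotient _ _ _) (y1 ord0 i) (y2 ord0 i) => q a b qm bE aE.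
(* If [a <= b], monotonicity of [q] makes the right side of [bE] at most that of [aE], hence
   [b <= a]. *)
wlog ab : a b aE bE / a <= b.
  by move=> W; have [/W|/ltW/W] := leP a b; last symmetry; auto.
apply/le_anti; rewrite ab /= [leLHS]bE aE lerD2l lerN2 ler_pM2l //.
by apply: qm; rewrite lerB.
Qed.

End DifferenceQuotient.

Local Open Scope classical_set_scope.

(** Moves the pairing of [y1 - y2] with the averaged gradients under the integral, where
    monotonicity holds pointwise. *)
Lemma Rintegral_sum_mulr d (T : measurableType d) (R : realType)
    (mu : {measure set T -> \bar R}) (I : Type) (r : seq I) (D : set T)
    (c : I -> R) (g : I -> T -> R) : measurable D ->
  (forall i, mu.-integrable D (EFin \o g i)) ->
  \sum_(i <- r) c i * \int[mu]_(s in D) g i s =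
  \int[mu]_(s in D) (\sum_(i <- r) c i * g i s).
Proof.
move=> mD ig.
have icg i : mu.-integrable D (EFin \o (fun s => c i * g i s)).
  by apply: (eq_integrable mD _ _ _ (integrableZl mD (c i) (ig i))) => s _;
    rewrite /= EFinM.
elim: r => [|i r IH].
  rewrite big_nil; under eq_Rintegral do rewrite big_nil.
  by rewrite Rintegral_cst // mul0r.
under [RHS]eq_Rintegral do rewrite big_cons.
rewrite big_cons IH RintegralD // ?RintegralZl //.
have := @integrable_sum _ _ _ mu D mD _ r xpredT _ (fun j _ => icg j).
by apply: eq_integrable => // s _; rewrite /= sumEFin.
Qed.

Section MeanValue.
Context {R : realType} {n : nat}.
Notation mu := (@lebesgue_measure R).

Lemma grad_segment_integrable (V : 'rV[R]_n -> R) (x y : 'rV[R]_n) (i : 'I_n) :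
  continuous (grad V) ->
  mu.-integrable `[0, 1]
    (EFin \o fun s => grad V ((1 - s) *: x + s *: y) ord0 i).
Proof.
move=> cG; have cl : continuous (fun s : R => (1 - s) *: x + s *: y).
  move=> s; apply: cvgD; apply: cvgZr_tmp; last exact: cvg_id.
  by apply: cvgB; [exact: cvg_cst|exact: cvg_id].
apply: continuous_compact_integrable; first exact: segment_compact.
apply: continuous_subspaceT => s.
exact: (continuous_comp (continuous_comp (cl s) (cG _))
  (@coord_continuous R 1 n ord0 i _)).
Qed.

Lemma mean_value_step_inj (V : 'rV[R]_n -> R) (x y1 y2 : 'rV[R]_n) (tau : R) :
  convex_along_lines V -> continuously_differentiable V -> 0 < tau ->
  y1 = x - tau *: mean_value_dgrad V x y1 ->
  y2 = x - tau *: mean_value_dgrad V x y2 -> y1 = y2.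
Proof.
move=> cV [dV cG] tau0 y1E y2E.
pose g y i s := grad V ((1 - s) *: x + s *: y) ord0 i.
have ig y i : mu.-integrable `[0, 1] (EFin \o g y i).
  exact: grad_segment_integrable.
have diffE i : y1 ord0 i - y2 ord0 i =
    - tau * \int[mu]_(s in `[0, 1]) (g y1 i s - g y2 i s).
  have coord y : y = x - tau *: mean_value_dgrad V x y ->
      y ord0 i = x ord0 i - tau * \int[mu]_(s in `[0, 1]) g y i s.
    by move=> yE; rewrite {1}yE !mxE.
  rewrite (coord _ y1E) (coord _ y2E) RintegralB //.
  by rewrite [LHS]addrC opprB subrKA -mulrBr mulNr -mulrN opprB.
have sq_le0 : \sum_(i < n) (y1 ord0 i - y2 ord0 i) ^+ 2 <= 0.
  (* Only one factor of each square is replaced by its integral formula; the other stays as the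
     vector to pair with. *)
  under eq_bigr => i _ do rewrite expr2 {2}diffE mulrCA.
  rewrite -mulr_sumr mulNr oppr_le0 mulr_ge0 ?(ltW tau0) //.
  rewrite (@Rintegral_sum_mulr _ _ _ mu _ _ `[0, 1]
    (fun i => y1 ord0 i - y2 ord0 i)
    (fun i s => g y1 i s - g y2 i s)) //; last first.
    by move=> i; have := integrableB _ (ig y1 i) (ig y2 i); apply.
  apply: Rintegral_ge0 => s; rewrite /= in_itv /= => /andP[s0 _].
  (* At [s = 0] both points are [x] and the integrand vanishes. For [s > 0], multiplying by [s]
     turns [y1 - y2] into the difference of the two points. *)
  have [->|sn0] := eqVneq s 0.
    by rewrite big1 // => i _; rewrite /g !scale0r !addr0 subrr mulr0.
  have {sn0}s0 : 0 < s by rewrite lt_neqAle eq_sym sn0.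
  rewrite -(pmulr_rge0 _ s0) mulr_sumr.
  have := grad_monotone V
    ((1 - s) *: x + s *: y1) ((1 - s) *: x + s *: y2) cV dV.
  congr (0 <= _); apply: eq_bigr => i _; rewrite mulrA; congr (_ * _).
  by rewrite !mxE; ring.
apply/rowP => i; apply/eqP; rewrite -subr_eq0 -sqrf_eq0.
have : \sum_(i < n) (y1 ord0 i - y2 ord0 i) ^+ 2 == 0.
  by rewrite eq_le sq_le0 sumr_ge0 // => j _; rewrite sqr_ge0.
by rewrite psumr_eq0 => [/allP/(_ i)|j _]; rewrite ?sqr_ge0//
  mem_index_enum => /(_ isT).
Qed.

End MeanValue.

Theorem lemma5p1 (R : realType) (n : nat) (V : 'rV[R]_n -> R) (mu : R)
    (V_C1 : continuously_differentiable V)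
    (mu_ge0 : 0 <= mu) (V_convex : mu_convex mu V)
    (x : 'rV[R]_n) (tau : R) (tau_gt0 : 0 < tau)
    (dgrad : 'rV[R]_n -> 'rV[R]_n -> 'rV[R]_n)
    (dgradE : dgrad = mean_value_dgrad V \/ dgrad = itoh_abe_dgrad V)
    (y1 y2 : 'rV[R]_n)
    (y1_sol : y1 = x - tau *: dgrad x y1)
    (y2_sol : y2 = x - tau *: dgrad x y2) :
  y1 = y2.
Proof.
have cV := mu_convex_along_lines mu V mu_ge0 V_convex.
case: dgradE y1_sol y2_sol => ->.
  exact: mean_value_step_inj.
by case: V_C1 => dV _; exact: itoh_abe_step_inj.
Qed.
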